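(* Let $(a_n)_{n\ge 1}$ be an infinite PLP sequence. If $\sum_{n=1}^\infty \frac{1}{a_n}=\infty$, then the sequence contains infinitely many prime numbers (that is, $a_n$ is prime for infinitely many $n$).
   Context: A sequence of natural numbers is called a PLP sequence if it is strictly increasing, its terms are pairwise relatively prime, and all its terms are greater than $1$. *)

(* Defs.v *)
From mathcomp Require Import all_boot.

Set Implicit Arguments.
Unset Strict Implicit.
Unset Printing Implicit Defensive.

(* Infinite PLP sequences.  The sequence (a_n), n >= 1, is indexed from 0:
   a_n is [a n.-1]. *)
Definition PLP (a : nat -> nat) : Prop :=
  [/\ {homo a : m n / m < n},
      forall m n : nat, m != n -> coprime (a m) (a n)
    & forall n : nat, 1 < a n].

(* Main.v *)
Require Import Defs.
From mathcomp Require Import all_boot all_order all_algebra.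
From mathcomp Require Import all_classical all_reals all_analysis.
From mathcomp Require Import ring lra.

(** Suppose that only finitely many terms are prime, so that every [a n] with
    [n >= N] is composite.  Write [p_n] for the least prime factor of [a n];
    for [n >= N] it satisfies [p_n ^ 2 <= a n], so [1 / a n <= 1 / p_n ^ 2].
    Pairwise coprimality makes the [p_n] pairwise distinct, hence the tail of
    the series is bounded by the sum of [1 / k ^ 2] over all [k >= 2], which
    converges (it is at most [1] by telescoping).  So the series of inverses
    has bounded partial sums: a contradiction.  Lemma [sum_inv_composite_le1]
    bounds the tail, and [sum_inv_sqr_uniq_le1] bounds the sum of inverse
    squares. *)

Set Implicit Arguments.
Unset Strict Implicit.
Unset Printing Implicit Defensive.

Import Order.TTheory GRing.Theory Num.Theory.

Local Open Scope classical_set_scope.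
Local Open Scope ring_scope.

(** Comparison with the telescoping series of
    [1 / (k (k - 1)) = 1 / (k - 1) - 1 / k]. *)
Lemma sum_inv_sqr_le1 (R : realFieldType) (m : nat) :
  \sum_(2 <= k < m) (k%:R ^+ 2)^-1 <= 1 :> R.
Proof.
have [m_le2|/ltnW m_ge2] := leqP m 2; first by rewrite big_geq.
have le_telescope k : (2 <= k < m)%N ->
    (k%:R ^+ 2)^-1 <= - (k.+1.-1%:R)^-1 - - (k.-1%:R)^-1 :> R.
  case: k => [|[|k]] // _; rewrite opprK /= addrC.
  have k_gt0 : 0 < k.+1%:R :> R by rewrite ltr0n.
  rewrite -(natr1 k.+1); set x : R := k.+1%:R in k_gt0 *.
  have x1_gt0 : 0 < x + 1 by lra.
  have -> : x^-1 - (x + 1)^-1 = (x * (x + 1))^-1.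
    by field; rewrite !lt0r_neq0.
  by rewrite lef_pV2 ?posrE ?mulr_gt0 ?exprn_gt0 // expr2 ler_wpM2r; lra.
apply: le_trans (ler_sum_nat le_telescope) _.
rewrite (telescope_sumr (fun k => - (k.-1%:R)^-1 : R)) //= opprK invr1.
by rewrite gerDr oppr_le0 invr_ge0 ler0n.
Qed.

(** The entries of [s] are a subset of an integer interval starting at [2],
    and the terms are nonnegative. *)
Lemma sum_inv_sqr_uniq_le1 (R : realFieldType) (s : seq nat) :
  uniq s -> all (leq 2) s -> \sum_(k <- s) (k%:R ^+ 2)^-1 <= 1 :> R.
Proof.
move=> s_uniq /allP s_ge2.
pose m := (\max_(k <- s) k).+1.
have perm_s : perm_eq s [seq k <- index_iota 2 m | k \in s].
  apply: uniq_perm; rewrite ?filter_uniq ?iota_uniq // => k.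
  rewrite mem_filter mem_index_iota; case k_s: (k \in s) => //=.
  by rewrite s_ge2 // ltnS (leq_bigmax_seq _ k_s).
apply: le_trans (sum_inv_sqr_le1 R m).
rewrite (perm_big _ perm_s) /= big_filter big_mkcond; apply: ler_sum => k _.
by case: ifP => // _; rewrite invr_ge0 exprn_ge0 // ler0n.
Qed.

(** A composite number is at least the square of its least prime factor, and
    coprime terms have different least prime factors. *)
Lemma sum_inv_composite_le1 (R : realFieldType) (a : nat -> nat) (N M : nat) :
  PLP a -> (forall n, (N <= n)%N -> ~~ prime (a n)) ->
  \sum_(N <= n < M) (a n)%:R^-1 <= 1 :> R.
Proof.
case=> _ a_coprime a_gt1 a_composite.
have p_prime n : prime (pdiv (a n)) by rewrite pdiv_prime.
have p_inj : injective (pdiv \o a).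
  move=> i j /= eq_p; apply/eqP/negPn/negP => /a_coprime.
  move=> /(coprime_dvdl (pdiv_dvd _)) /(coprime_dvdr (pdiv_dvd _)).
  by rewrite -eq_p prime_coprime // dvdnn.
apply: (@le_trans _ _
    (\sum_(k <- map (pdiv \o a) (index_iota N M)) (k%:R ^+ 2)^-1)).
  rewrite big_map; apply: ler_sum_nat => n /andP[le_Nn _] /=.
  have p_gt0 : (0 < pdiv (a n))%N by rewrite pdiv_gt0.
  rewrite lef_pV2 ?posrE ?exprn_gt0 ?ltr0n ?(ltnW (a_gt1 n)) //.
  rewrite -natrX ler_nat leqNgt; apply: contra (a_composite n le_Nn).
  exact/ltn_pdiv2_prime/ltnW.
apply: sum_inv_sqr_uniq_le1; first by rewrite map_inj_uniq // iota_uniq.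
by rewrite all_map; apply/allP => n _ /=; apply: prime_gt1.
Qed.

Theorem theorem3p2 (R : realType) (a : nat -> nat) (aPLP : PLP a)
    (sum_inv : (\sum_(0 <= n <oo) ((a n)%:R^-1 : R)%:E = +oo)%E) :
  infinite_set [set n : nat | prime (a n)].
Proof.
move=> /finite_seqP[s prime_s].
pose N := (\max_(n <- s) n).+1.
have composite_N n : (N <= n)%N -> ~~ prime (a n).
  move=> le_Nn; apply/negP => a_prime.
  have /= n_s : [set` s] n by rewrite -prime_s.
  by move: le_Nn; rewrite ltnNge (leq_bigmax_seq _ n_s).
suff : (\sum_(0 <= n <oo) ((a n)%:R^-1 : R)%:E
    <= (\sum_(0 <= n < N) (a n)%:R^-1 + 1)%:E)%E.
  by rewrite sum_inv leye_eq.
apply: lime_le.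
  by apply: is_cvg_nneseries => n _ _; rewrite lee_fin invr_ge0 ler0n.
near=> M.
have le_NM : (N <= M)%N by near: M; exact: nbhs_infty_ge.
rewrite sumEFin lee_fin (big_cat_nat (leq0n N) le_NM) //= lerD2l.
exact: sum_inv_composite_le1.
Unshelve. all: by end_near. Qed.
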